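(* Let $3/2<p<3$. Then $B(L^p[0,1])$, with the operator norm, has the uniform ball-covering property.
   Context: $B(X)$ is the space of bounded linear operators on the Banach space $X$. A normed space $Y$ with unit sphere $S_Y$ has the uniform ball-covering property (UBCP) if there exist a sequence of open balls $(B(y_n,r_n))_{n=1}^\infty$ in $Y$ and a real number $r>0$ such that $S_Y\subseteq\bigcup_{n=1}^\infty B(y_n,r_n)$, $0\notin B(y_n,r_n)$ for every $n$, the radii $(r_n)$ are bounded, and $B(y_n,r_n)\cap B(0,r)=\emptyset$ for every $n\ge 1$. *)

(* Defs.v *)
From HB Require Import structures.
From mathcomp Require Import all_boot all_order all_algebra.
From mathcomp Require Import all_classical all_reals all_analysis.
From mathcomp Require Import measurable_realfun ess_sup_inf.

Set Implicit Arguments.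
Unset Strict Implicit.
Unset Printing Implicit Defensive.
Import Order.TTheory GRing.Theory Num.Theory.
Import numFieldNormedType.Exports.
Local Open Scope classical_set_scope.
Local Open Scope ring_scope.

Section Lnorm_ae.
Context d (T : measurableType d) (R : realType).
Variables (mu : {measure set T -> \bar R}) (p : \bar R).
Local Open Scope ereal_scope.

Lemma ae_eq_Lnorm (f g : T -> R) :
  measurable_fun [set: T] f -> measurable_fun [set: T] g ->
  f = g %[ae mu] -> 'N[mu]_p[EFin \o f] = 'N[mu]_p[EFin \o g].
Proof.
move=> mf mg fg; rewrite unlock; case: p => [r| |].
- congr (_ `^ _); apply: ge0_ae_eq_integral => //.
  + apply: (measurableT_comp (measurable_poweR _)).
    by apply: measurableT_comp => //; exact/measurable_EFinP.
  + apply: (measurableT_comp (measurable_poweR _)).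
    by apply: measurableT_comp => //; exact/measurable_EFinP.
  + by move=> x _; exact: poweR_ge0.
  + by move=> x _; exact: poweR_ge0.
  + by apply: filterS fg => x /= fgx _; rewrite fgx.
- case: ifPn => // _; apply: eq_ess_sup.
  by apply: filterS fg => x /= fgx; rewrite fgx.
- case: ifPn => // _; apply: eq_ess_inf.
  by apply: filterS fg => x /= fgx; rewrite fgx.
Qed.

End Lnorm_ae.

(* The library type [LspaceType mu p1] (classes modulo mu-a.e. equality) comes
   without algebraic structure; this section makes it a normed space. *)
Section Lspace_normed.
Context d (T : measurableType d) (R : realType).
Variables (mu : {measure set T -> \bar R}) (p : \bar R) (p1 : (1 <= p)%E).

Local Notation Lf := (LfunType mu p1).
Local Notation Ls := (LspaceType mu p1).
Local Notation Q := {mfun_ mu, T >-> measurableTypeR R}.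

(* [LspaceType] is a quotient of functions into [measurableTypeR R], whereas
   [LfunType] uses the (equal) measurable structure on [R]. *)
Definition Lclass_mfun (f : Lf) : {mfun T >-> measurableTypeR R} :=
  mfun_Sub (mem_set (measurable_funPT f) : (f : T -> measurableTypeR R) \in mfun).

Lemma Lclass_mfun_ae (f : Lf) :
  ((\pi_Q%qT (Lclass_mfun f) : Q) : T -> R) = f %[ae mu].
Proof.
rewrite /aqEqMfun_to_fun.
have /eqquotP/asboolP :
    (repr (\pi_Q (Lclass_mfun f)) = Lclass_mfun f %[mod Q])%qT.
  by rewrite reprK.
exact.
Qed.

Lemma measurable_Q (q : Q) : measurable_fun [set: T] (q : T -> R).
Proof. exact: (measurable_funPT (repr q)). Qed.

Lemma Lclass_finite (f : Lf) : finite_norm mu p (\pi_Q%qT (Lclass_mfun f) : Q).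
Proof.
rewrite /finite_norm (ae_eq_Lnorm _ _ _ (Lclass_mfun_ae f)).
- exact: Lfunction_finite.
- exact: measurable_Q.
- exact: measurable_funPT.
Qed.

Definition Lclass (f : Lf) : Ls :=
  LebesgueSpace.Pack (LebesgueSpace.Class
    (isFinLebesgue.Axioms_ T R mu p p1 _ (Lclass_finite f))).

Lemma Lrepr_subproof (f : Ls) : (f : T -> R) \in Lfun mu p.
Proof.
apply/andP; split; apply/mem_set; first exact: measurable_Q.
by case: f => f [[]].
Qed.

Definition Lrepr (f : Ls) : Lf := Lfun_Sub p1 (Lrepr_subproof f).

Lemma Lclass_ae (f : Lf) : (Lclass f : T -> R) = f %[ae mu].
Proof. exact: Lclass_mfun_ae. Qed.

Lemma Lspace_eqP (f g : Ls) : (f : T -> R) = g %[ae mu] -> f = g.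
Proof.
case: f => f [[ff]]; case: g => g [[fg]] /= fgae.
have E : f = g.
  rewrite -(reprK f) -(reprK g); apply/eqquotP/asboolP; exact: fgae.
by subst g; congr (LebesgueSpace.Pack (LebesgueSpace.Class
    (isFinLebesgue.Axioms_ T R mu p p1 _ _))); exact: Prop_irrelevance.
Qed.

Lemma Lclass_eq (f g : Lf) : (f : T -> R) = g %[ae mu] -> Lclass f = Lclass g.
Proof.
move=> fg; apply: Lspace_eqP; apply: ae_eq_trans (Lclass_ae f) _.
by apply: ae_eq_trans fg _; apply: ae_eq_sym; exact: Lclass_ae.
Qed.

Lemma LreprK : cancel Lrepr Lclass.
Proof. by move=> f; apply: Lspace_eqP; exact: Lclass_ae. Qed.

HB.instance Definition _ := Choice.copy Ls (can_type LreprK).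

Definition Lspace_zero : Ls := Lclass 0.
Definition Lspace_opp (f : Ls) : Ls := Lclass (- Lrepr f).
Definition Lspace_add (f g : Ls) : Ls := Lclass (Lrepr f + Lrepr g).
Definition Lspace_scale (a : R) (f : Ls) : Ls := Lclass (a *: Lrepr f).

Lemma LclassN (f : Lf) : Lspace_opp (Lclass f) = Lclass (- f).
Proof.
apply: Lclass_eq; apply: filterS (Lclass_ae f) => x /= /(_ I) + _.
by move=> fx; rewrite -[LHS]/(- (Lclass f x)) fx.
Qed.

Lemma LclassD (f g : Lf) : Lspace_add (Lclass f) (Lclass g) = Lclass (f + g).
Proof.
apply: Lclass_eq; apply: filterS2 (Lclass_ae f) (Lclass_ae g).
move=> x /= /(_ I) fx /(_ I) gx _.
by rewrite -[LHS]/(Lclass f x + Lclass g x) fx gx.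
Qed.

Lemma LclassZ a (f : Lf) : Lspace_scale a (Lclass f) = Lclass (a *: f).
Proof.
apply: Lclass_eq; apply: filterS (Lclass_ae f) => x /= /(_ I) + _.
by move=> fx; rewrite -[LHS]/(a * (Lclass f x)) fx.
Qed.

Lemma Lspace_addA : associative Lspace_add.
Proof.
by move=> f g h; rewrite -(LreprK f) -(LreprK g) -(LreprK h) !LclassD addrA.
Qed.

Lemma Lspace_addC : commutative Lspace_add.
Proof. by move=> f g; rewrite /Lspace_add addrC. Qed.

Lemma Lspace_add0 : left_id Lspace_zero Lspace_add.
Proof. by move=> f; rewrite -(LreprK f) LclassD add0r. Qed.

Lemma Lspace_addN : left_inverse Lspace_zero Lspace_opp Lspace_add.
Proof. by move=> f; rewrite -(LreprK f) LclassN LclassD addNr. Qed.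

HB.instance Definition _ := GRing.isZmodule.Build Ls
  Lspace_addA Lspace_addC Lspace_add0 Lspace_addN.

Lemma Lspace_scaleA a b (f : Ls) :
  Lspace_scale a (Lspace_scale b f) = Lspace_scale (a * b) f.
Proof. by rewrite -(LreprK f) !LclassZ scalerA. Qed.

Lemma Lspace_scale1 : left_id 1 Lspace_scale.
Proof. by move=> f; rewrite -(LreprK f) LclassZ scale1r. Qed.

Lemma Lspace_scaleDr : right_distributive Lspace_scale +%R.
Proof.
move=> a f g; rewrite -(LreprK f) -(LreprK g).
rewrite -[Lclass _ + Lclass _]/(Lspace_add _ _) LclassD !LclassZ scalerDr.
by rewrite -LclassD.
Qed.

Lemma Lspace_scaleDl (f : Ls) : {morph Lspace_scale^~ f : a b / a + b}.
Proof. by move=> a b; rewrite -(LreprK f) !LclassZ scalerDl -LclassD. Qed.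

HB.instance Definition _ := GRing.Zmodule_isLmodule.Build R Ls
  Lspace_scaleA Lspace_scale1 Lspace_scaleDr Lspace_scaleDl.

Definition Lspace_norm (f : Ls) : R := fine ('N[mu]_p[EFin \o f])%E.

Lemma Lspace_norm_class (f : Lf) :
  Lspace_norm (Lclass f) = fine ('N[mu]_p[EFin \o f])%E.
Proof.
rewrite /Lspace_norm (ae_eq_Lnorm _ _ _ (Lclass_ae f)) //.
exact: measurable_Q.
Qed.

Lemma ler_Lspace_normD (f g : Ls) :
  Lspace_norm (f + g) <= Lspace_norm f + Lspace_norm g.
Proof.
rewrite [f + g]/(Lspace_add f g) Lspace_norm_class.
exact: (ler_LnormD (Lrepr f) (Lrepr g)).
Qed.

Lemma Lspace_normZ a (f : Ls) : Lspace_norm (a *: f) = `|a| * Lspace_norm f.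
Proof.
rewrite [a *: f]/(Lspace_scale a f) Lspace_norm_class.
rewrite (_ : 'N[mu]_p[_]%E = 'N[mu]_p[EFin \o (a \*: (Lrepr f : T -> R))])%E //.
by rewrite LnormZ -(finite_norm_fine (Lrepr f)).
Qed.

Lemma Lspace_norm0_eq0 (f : Ls) : Lspace_norm f = 0 -> f = 0.
Proof.
move=> f0; rewrite -(LreprK f); apply: Lclass_eq.
exact: (fine_Lnormr_eq0 (f0 : fine ('N[mu]_p[EFin \o (Lrepr f)])%E = 0)).
Qed.

HB.instance Definition _ := Lmodule_isNormed.Build R Ls
  ler_Lspace_normD Lspace_normZ Lspace_norm0_eq0.

Lemma Lspace_normE (f : Ls) : `|f| = fine ('N[mu]_p[EFin \o f])%E.
Proof. by []. Qed.

End Lspace_normed.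

Section bounded_operators.
Context (R : realType) (X : normedModType R).

Definition bounded_operator : {pred X -> X} := mem [set f : X -> X |
  linear f /\ exists M : R, forall x, `|f x| <= M * `|x|].

Lemma bounded_operator_submod_closed : submod_closed bounded_operator.
Proof.
split.
- have E z : (0 : X -> X) z = 0 by [].
  apply/mem_set; split; first by move=> a x y; rewrite !E scaler0 addr0.
  by exists 0 => x; rewrite E normr0 mul0r.
- move=> a f g /set_mem[lf [M fM]] /set_mem[lg [N gN]].
  have E z : (a *: f + g) z = a *: f z + g z by [].
  apply/mem_set; split.
    move=> b x y; rewrite !E lf lg !scalerDr !scalerA (mulrC a b).
    by rewrite !addrA; congr (_ + _); rewrite -!addrA; congr (_ + _); exact: addrC.
  exists (`|a| * M + N) => x; rewrite E (le_trans (ler_normD _ _))//.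
  by rewrite mulrDl lerD// normrZ -mulrA ler_wpM2l.
Qed.

HB.instance Definition _ := GRing.isSubmodClosed.Build R (X -> X)
  bounded_operator bounded_operator_submod_closed.

Record Bop := MkBop {
  Bop_fun :> X -> X;
  Bop_fun_bounded : Bop_fun \in bounded_operator }.

HB.instance Definition _ := [isSub for Bop_fun].
HB.instance Definition _ := [Choice of Bop by <:].
HB.instance Definition _ := [SubChoice_isSubLmodule of Bop by <:].

Definition opnorm (f : Bop) : R := sup [set `|f x| | x in [set x | `|x| <= 1]].

Lemma Bop_linear (f : Bop) : linear f.
Proof. by case: f => f /= /set_mem[]. Qed.

Lemma Bop_bounded (f : Bop) : exists M : R, forall x, `|f x| <= M * `|x|.
Proof. by case: f => f /= /set_mem[]. Qed.

Lemma Bop0 (f : Bop) : f 0 = 0.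
Proof.
have := Bop_linear f 1 0 0; rewrite !scale1r addr0 => h.
by apply: (addrI (f 0)); rewrite addr0 -h.
Qed.

Lemma BopZ (f : Bop) a x : f (a *: x) = a *: f x.
Proof. by have := Bop_linear f a x 0; rewrite addr0 Bop0 addr0. Qed.

Lemma opnorm_has_sup (f : Bop) :
  has_sup [set `|f x| | x in [set x | `|x| <= 1]].
Proof.
split; first by exists `|f 0|, 0 => //=; rewrite normr0.
have [M fM] := Bop_bounded f; exists `|M| => _ [x /= x1 <-].
rewrite (le_trans (fM x))// (le_trans (ler_wpM2r _ (ler_norm M)))//.
by rewrite ler_piMr.
Qed.

Lemma opnorm_ge (f : Bop) x : `|x| <= 1 -> `|f x| <= opnorm f.
Proof. by move=> x1; apply: ub_le_sup; [exact: (opnorm_has_sup f).2|exists x]. Qed.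

Lemma opnorm_le (f : Bop) M :
  (forall x, `|x| <= 1 -> `|f x| <= M) -> opnorm f <= M.
Proof.
move=> fM; apply: ge_sup; first exact: (opnorm_has_sup f).1.
by move=> _ [x x1 <-]; exact: fM.
Qed.

Lemma opnorm_ge0 (f : Bop) : 0 <= opnorm f.
Proof.
by have := @opnorm_ge f 0; rewrite normr0 ler01 => /(_ isT); exact: le_trans.
Qed.

Lemma opnormP (f : Bop) x : `|f x| <= opnorm f * `|x|.
Proof.
have [->|x0] := eqVneq x 0; first by rewrite Bop0 !normr0 mulr0.
have nx0 : 0 < `|x| by rewrite normr_gt0.
rewrite -ler_pdivrMr// mulrC -[`|x|^-1]ger0_norm ?invr_ge0// -normrZ -BopZ.
by apply: opnorm_ge; rewrite normrZ normfV normr_id mulVf ?gt_eqF.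
Qed.

Lemma ler_opnormD (f g : Bop) : opnorm (f + g) <= opnorm f + opnorm g.
Proof.
apply: opnorm_le => x x1; rewrite -[(f + g) x]/(f x + g x).
by rewrite (le_trans (ler_normD _ _))// lerD// opnorm_ge.
Qed.

Lemma opnormZ a (f : Bop) : opnorm (a *: f) = `|a| * opnorm f.
Proof.
have le b (g : Bop) : opnorm (b *: g) <= `|b| * opnorm g.
  apply: opnorm_le => x x1; rewrite -[(b *: g) x]/(b *: g x) normrZ.
  by rewrite ler_wpM2l// opnorm_ge.
have [->|a0] := eqVneq a 0.
  by apply/le_anti; rewrite le normr0 mul0r opnorm_ge0.
apply/le_anti; rewrite le/= mulrC -ler_pdivlMr ?normr_gt0// mulrC -normfV.
by rewrite (le_trans _ (le _ _))// scalerA mulVf// scale1r.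
Qed.

Lemma opnorm0_eq0 (f : Bop) : opnorm f = 0 -> f = 0.
Proof.
move=> f0; apply/val_inj/funext => x /=; apply/eqP; rewrite -normr_le0.
by rewrite (le_trans (opnormP f x))// f0 mul0r.
Qed.

HB.instance Definition _ := Lmodule_isNormed.Build R Bop
  ler_opnormD opnormZ opnorm0_eq0.

Lemma Bop_normE (f : Bop) : `|f| = sup [set `|f x| | x in [set x | `|x| <= 1]].
Proof. by []. Qed.

End bounded_operators.

Definition UBCP (R : realType) (Y : normedModType R) : Prop :=
  exists (y : nat -> Y) (r : nat -> R) (rho : R),
    0 < rho /\ (forall n, 0 < r n) /\
    [/\ [set x : Y | `|x| = 1] `<=` \bigcup_n ball (y n) (r n),
        forall n, ~ ball (y n) (r n) 0,
        bounded_fun r &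
        forall n, ball (y n) (r n) `&` ball 0 rho = set0].

(* A function on the line is identified, up to equality almost everywhere for
   this measure, with its restriction to [0, 1]. *)
Definition lebesgue01 (R : realType) :
    {measure set (measurableTypeR R) -> \bar R} :=
  mrestr (@lebesgue_measure R)
    (measurable_itv `[0, 1] : measurable (`[0%R, 1%R] : set (measurableTypeR R))).

Definition Lp01 (R : realType) (p : R) (p1 : (1 <= p%:E)%E) : normedModType R :=
  LspaceType (lebesgue01 R) p1.

Lemma exponent_ge1 (R : realType) (p : R) : 3 / 2 < p < 3 -> (1 <= p%:E)%E.
Proof.
move=> /andP[p32 _]; rewrite lee_fin (le_trans _ (ltW p32))//.
by rewrite ler_pdivlMr// mul1r ler_nat.
Qed.

(* Main.v *)
Require Import Defs.
From mathcomp Require Import all_boot all_order all_algebra.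
From mathcomp Require Import all_classical all_reals all_analysis.
From mathcomp Require Import measurable_realfun.
From mathcomp Require Import ring lra.

Set Implicit Arguments.
Unset Strict Implicit.
Unset Printing Implicit Defensive.
Import Order.TTheory GRing.Theory Num.Theory.
Import numFieldNormedType.Exports.
Local Open Scope ring_scope.

(** Suppose that every unit vector [u] of a separable space [X] is exposed, with
    a modulus independent of [u], by a functional [f] of norm 1: [f v > 1 - t]
    on the unit ball forces [|u - v| < eps].  Given [T] of norm 1, choose [u]
    with [|T u|] close to 1, let [w] be close to [T u / |T u|], and put
    [S := f (.) w], an operator of norm 1.  For [|v| <= 1] and [f v >= 0],
    either [f v <= 1 - 2 t], and then [|S v - t T v| <= 1 - t], or [v] is
    close to [u] and [S v - t T v] is close to [(f v - t |T u|) w]; in both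
    cases [|S v - t T v| <= 1 - 6 t / 10].  So [T] lies at distance less than
    [1/t - 1/4] from [t^-1 S], which has norm [1/t]; by separability countably
    many such [S] suffice, and [t] does not depend on [T].

    In [L^p] with [p > 1], the exposing functional of [u] is integration against
    [u |u|^(p-2)].  The deficit [p (1 - f v)] dominates the integral of
    [|v|^p + (p-1) |u|^p - p u |u|^(p-2) v], and this nonnegative integrand
    controls [|u - v|^p] up to an arbitrarily small multiple of [|u|^p]. *)

(** * Rank-one operators and the covering of the unit sphere of [Bop X] *)

Section rank_one.
Context (R : realType) (X : normedModType R).

Definition exposes (f : X -> R) (u : X) (t eps : R) :=
  [/\ scalar f, forall v, `|f v| <= `|v|, f u = 1 &
      forall v, `|v| <= 1 -> 1 - t < f v -> `|u - v| < eps].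

Lemma rank_one_bounded (f : X -> R) (w : X) :
  scalar f -> (forall v, `|f v| <= `|v|) ->
  (fun v => f v *: w) \in @bounded_operator R X.
Proof.
move=> lf f1; apply/mem_set; split.
  by move=> a x y; rewrite lf scalerDl scalerA.
by exists `|w| => x; rewrite normrZ mulrC ler_wpM2l.
Qed.

Lemma ubcp_exposed (e : nat -> X) :
  (forall n, `|e n| = 1) ->
  (forall u eps, `|u| = 1 -> 0 < eps -> exists n, `|u - e n| < eps) ->
  (forall eps, 0 < eps -> exists2 t, 0 < t &
    forall u, `|u| = 1 -> exists f, exposes f u t eps) ->
  UBCP (Bop X).
Proof.
move=> e1 e_dense expo.
have e10 : 0 < 10^-1 :> R by rewrite invr_gt0 ltr0n.
have [t0 t00 ft] := expo _ e10.
have {ft}/choice[f fP] : forall n, exists f, exposes f (e n) t0 10^-1.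
  by move=> n; exact: ft.
(* With [t <= t0 / 2], [f v > 1 - 2 * t] implies the exposing condition for [t0]; with [t <= 1 / 4],
   the radius is positive and [c - t * m] below is nonnegative. *)
pose t := Num.min (t0 / 2) 4^-1.
have t_gt0 : 0 < t by rewrite lt_min; apply/andP; split; lra.
have t_ge0 := ltW t_gt0.
have t_t0 : 2 * t <= t0.
  have : t <= t0 / 2 by rewrite ge_min lexx.
  by lra.
have t4 : t <= 4^-1 by rewrite ge_min lexx orbT.
have bop i j : (fun v => f i v *: e j) \in @bounded_operator R X.
  by have [? ? _ _] := fP i; exact: rank_one_bounded.
pose S ij : Bop X := MkBop (bop ij.1 ij.2).
have SE ij v : S ij v = f ij.1 v *: e ij.2 by [].
have S1 ij : 1 <= `|S ij|.
  have [_ _ fe _] := fP ij.1.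
  have := @opnorm_ge _ _ (S ij) (e ij.1).
  by rewrite SE fe scale1r !e1; apply.
(* Integers that code no pair repeat the centre of index [(0, 0)]. *)
pose y n : Bop X :=
  if unpickle n is Some ij then t^-1 *: S ij else t^-1 *: S (0, 0)%N.
have yE n : exists ij, y n = t^-1 *: S ij.
  by rewrite /y; case: unpickle => [ij|]; [exists ij|exists (0, 0)%N].
have y_ge n : t^-1 <= `|y n|.
  have [ij ->] := yE n; rewrite normrZ ger0_norm ?invr_ge0// ler_peMr//.
  by rewrite invr_ge0.
have tV : 4 <= t^-1.
  by rewrite -(invrK 4) lef_pV2 ?posrE// invr_gt0 ltr0n.
(* All centres have norm at least [t^-1], so this radius leaves a gap [4^-1] around the origin. *)
exists y, (fun=> t^-1 - 4^-1), 4^-1; split; first by rewrite invr_gt0 ltr0n.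
split; first by move=> _; lra.
split.
- move=> T /= T1.
  have [u0 [u01 Tu0]] : exists u0, `|u0| = 1 /\ 9 / 10 < `|T u0|.
    have [_ [x x1 <-] Tx] : exists2 z,
        [set `|T x| | x in [set x | `|x| <= 1]]%classic z & 9 / 10 < z.
      by apply: sup_gt; [exact: (opnorm_has_sup T).1|rewrite -Bop_normE T1; lra].
    have x0 : 0 < `|x|.
      by rewrite normr_gt0; apply: contraTneq Tx => ->; rewrite Bop0 normr0 -leNgt; lra.
    exists (`|x|^-1 *: x); split.
      by rewrite normrZ normfV normr_id mulVf// gt_eqF.
    rewrite BopZ normrZ normfV normr_id (lt_le_trans Tx)// ler_peMl//.
    by rewrite -invr1 lef_pV2 ?posrE.
  have Tle v : `|T v| <= `|v| by rewrite -[leRHS]mul1r -T1; exact: opnormP.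
  have TB v w : T (v - w) = T v - T w.
    by rewrite addrC -scaleN1r Bop_linear scaleN1r addrC.
  have [i ei] : exists n, `|u0 - e n| < 10^-1.
    by apply: e_dense => //; rewrite invr_gt0 ltr0n.
  set m := `|T (e i)|.
  (* [|T u0| > 9 / 10], and passing from [u0] to [e i] costs at most [1 / 10]. *)
  have m8 : 8 / 10 <= m.
    have := ler_normD (T (u0 - e i)) (T (e i)); rewrite {1}TB subrK -/m.
    by have := Tle (u0 - e i); move: ei Tu0; lra.
  have m1 : m <= 1 by rewrite /m (le_trans (Tle _))// e1.
  pose w := m^-1 *: T (e i).
  have w1 : `|w| = 1.
    by rewrite /w normrZ -/m ger0_norm ?mulVf ?gt_eqF ?invr_ge0//; lra.
  have mw : m *: w = T (e i) by rewrite /w scalerA divff ?scale1r// gt_eqF//; lra.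
  have [j ej] : exists n, `|w - e n| < t / 10 by apply: e_dense => //; lra.
  have [lf f1 fe fs] := fP i.
  have key v : `|v| <= 1 -> 0 <= f i v -> `|f i v *: e j - t *: T v| <= 1 - 6 / 10 * t.
    move=> v1 fv0; set c := f i v.
    have tTv : `|t *: T v| <= t.
      by rewrite normrZ gtr0_norm// ler_piMr// (le_trans (Tle _)).
    have c1 : c <= 1 by rewrite (le_trans (ler_norm _))// (le_trans (f1 _)).
    have [cle|cgt] := leP c (1 - 2 * t).
      rewrite (le_trans (ler_normB _ _))// normrZ e1 mulr1 ger0_norm//.
      by move: tTv; lra.
    have vei : `|e i - v| < 10^-1 by apply: fs => //; move: cgt; rewrite /c; lra.
    (* The three terms have norms at most [t / 10], [1 - 8 / 10 * t] and [t / 10]; the outer ones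
       are the errors of replacing [w] by [e j] and [v] by [e i]. *)
    rewrite (_ : _ - _ = - (c *: (w - e j)) +
      ((c - t * m) *: w + t *: T (e i - v))); last first.
      rewrite scalerBr scalerBl TB scalerBr -(scalerA t m) mw.
      rewrite opprB -!addrA; congr (_ + _).
      by rewrite !addKr.
    rewrite (le_trans (ler_normD _ _))// normrN normrZ ger0_norm//.
    have h1 : c * `|w - e j| <= t / 10.
      by rewrite (le_trans _ (ltW ej))// ler_piMl.
    have h2 : `|(c - t * m) *: w| <= 1 - t * m.
      rewrite normrZ w1 mulr1 ger0_norm ?lerB// subr_ge0.
      by rewrite (le_trans (ler_piMr t_ge0 m1))//; lra.
    have h3 : `|t *: T (e i - v)| <= t / 10.
      rewrite normrZ gtr0_norm// ler_wpM2l// ltW//.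
      by rewrite (le_lt_trans (Tle _)).
    have := ler_normD ((c - t * m) *: w) (t *: T (e i - v)).
    have : 8 / 10 * t <= t * m by rewrite mulrC ler_wpM2l// ltW.
    by lra.
  exists (pickle (i, j)) => //; rewrite -ball_normE /= /y pickleK.
  (* Divided by [t], the bound of [key] is [t^-1 - 6 / 10], which is below the radius. *)
  apply: (@le_lt_trans _ _ (t^-1 * (1 - 6 / 10 * t))); last first.
    rewrite mulrBr mulr1 mulrCA mulVf ?gt_eqF// mulr1; lra.
  apply: opnorm_le => v v1.
  rewrite -[(_ - _ : Bop X) v]/(t^-1 *: (f i v *: e j) - T v).
  rewrite -[T v](scalerK (a := t)) ?gt_eqF// -scalerBr normrZ.
  rewrite ger0_norm ?invr_ge0// ler_wpM2l ?invr_ge0//.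
  (* The operator is odd, so a negative [f i v] is treated through [- v]. *)
  have [|fv0] := leP 0 (f i v); first exact: key.
  have fN : f i (- v) = - f i v.
    have f0 : f i 0 = 0 by apply/eqP; rewrite -normr_le0 (le_trans (f1 _)) ?normr0.
    by have := lf (-1) v 0; rewrite scaleN1r addr0 f0 addr0 => ->; rewrite mulN1r.
  have := key (- v); rewrite normrN fN oppr_ge0 => /(_ v1 (ltW fv0)).
  by rewrite -[- v]scaleN1r BopZ scaleN1r scalerN scaleNr -opprD normrN.
- move=> n; rewrite -ball_normE /= subr0; apply/negP; rewrite -leNgt.
  by rewrite (le_trans _ (y_ge n))//; lra.
- exists (t^-1); split; first exact: num_real.
  move=> z tz n _ /=; rewrite ger0_norm; move: tz; lra.
- move=> n; apply/seteqP; split => // z [].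
  rewrite -ball_normE /= sub0r normrN => yz z4.
  have := y_ge n; have := ler_normD (y n - z) z; rewrite subrK.
  by move: yz z4; lra.
Qed.

End rank_one.

Lemma measurable_powR_norm d (T : measurableType d) (R : realType) (p : R)
    (f : T -> R) :
  measurable_fun [set: T] f -> measurable_fun [set: T] (fun x => `|f x| `^ p).
Proof.
move=> mf; apply: (@measurableT_comp _ _ _ _ _ _ (@powR R ^~ p)) => //.
exact: measurableT_comp.
Qed.

(** * Scalar inequalities for the Bregman divergence of the [p]-th power *)

Section bregman.
Context (R : realType) (p : R).
Hypothesis p_gt1 : 1 < p.

Let p_gt0 : 0 < p := lt_trans ltr01 p_gt1.

(* At [a = 0] the power takes a junk value, killed by the factor [a]. *)
Definition dual_pow (a : R) : R := a * `|a| `^ (p - 2).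

(** As [dual_pow a * a] is [|a| ^ p], this is the Bregman divergence [|b| ^ p - |a| ^ p - p *
    dual_pow a * (b - a)]. *)
Definition bregman (a b : R) : R :=
  `|b| `^ p + (p - 1) * `|a| `^ p - p * (dual_pow a * b).

(** Young's inequality for [b] and [a ^ (p - 1)] with conjugate exponents [p] and [p / (p - 1)],
    multiplied by [p]. *)
Lemma young_powR (a b : R) : 0 <= a -> 0 <= b ->
  p * (a `^ (p - 1) * b) <= b `^ p + (p - 1) * a `^ p.
Proof.
move=> a0 b0; have p10 : 0 < p - 1 by rewrite subr_gt0.
have pq : p^-1 + (p / (p - 1))^-1 = 1.
  by field; apply/andP; split; rewrite gt_eqF.
have := conjugate_powR b0 (powR_ge0 a (p - 1)) p_gt0 (divr_gt0 p_gt0 p10) pq.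
rewrite -powRrM mulrCA divff ?gt_eqF// mulr1 -(ler_pM2l p_gt0) mulrDr.
rewrite [b * _]mulrC => /le_trans; apply.
by rewrite le_eqVlt; apply/orP; left; apply/eqP; field; rewrite !gt_eqF.
Qed.

Lemma norm_dual_pow a : `|dual_pow a| = `|a| `^ (p - 1).
Proof.
rewrite /dual_pow normrM (ger0_norm (powR_ge0 _ _)).
by rewrite (_ : p - 2 = p - 1 - 1) ?mulr_powRB1 ?subr_gt0//; ring.
Qed.

Lemma dual_powM a : dual_pow a * a = `|a| `^ p.
Proof.
rewrite -(mulr_powRB1 (normr_ge0 a) p_gt0) -norm_dual_pow -normrM.
by rewrite mulrC ger0_norm// /dual_pow mulrA mulr_ge0 ?powR_ge0// -expr2 sqr_ge0.
Qed.

Lemma measurable_dual_pow : measurable_fun [set: R] dual_pow.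
Proof.
apply: measurable_funM => //.
by exact: (@measurable_powR_norm _ _ _ (p - 2) id).
Qed.

Lemma norm_dual_powM_le a b :
  p * `|dual_pow a * b| <= `|b| `^ p + (p - 1) * `|a| `^ p.
Proof.
apply: le_trans (young_powR (normr_ge0 a) (normr_ge0 b)).
by rewrite normrM norm_dual_pow.
Qed.

Lemma bregman_ge0 a b : 0 <= bregman a b.
Proof.
rewrite subr_ge0; apply: le_trans (norm_dual_powM_le a b).
by rewrite ler_wpM2l ?(ltW p_gt0)// ler_norm.
Qed.

Lemma bregman1 b : bregman 1 b = `|b| `^ p + (p - 1) - p * b.
Proof. by rewrite /bregman /dual_pow normr1 !powR1 !mul1r mulr1. Qed.

(** Homogeneity reduces the estimates to the base point 1. *)
Lemma bregmanZ a b : bregman a (a * b) = `|a| `^ p * bregman 1 b.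
Proof.
rewrite bregman1 /bregman (mulrA _ a b) dual_powM normrM powRM//; ring.
Qed.

(* The tangent to [x ^ p] at [c] lies below the graph; its slope is compared
   with the slope at 1. *)
Lemma bregman1_ge c b : 0 <= c ->
  p * (c `^ (p - 1) - 1) * (b - c) <= bregman 1 b.
Proof.
move=> c0; have := young_powR c0 (normr_ge0 b).
have := bregman_ge0 1 c; rewrite !bregman1 (ger0_norm c0).
rewrite -(mulr_powRB1 c0 p_gt0).
set C := c `^ (p - 1).
have : p * (C * b) <= p * (C * `|b|).
  by rewrite ler_wpM2l ?(ltW p_gt0)// ler_wpM2l ?powR_ge0// ler_norm.
nra.
Qed.

(** The tangent bound is used at [1 + delta / 2] or [1 - delta / 2], whichever lies between 1 and
    [b]: the slope there differs strictly from the slope at 1, and [b] is at least [delta / 2]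
    further away. [delta < 2] keeps the lower point positive. *)
Lemma bregman1_gap (delta : R) : 0 < delta < 2 -> exists2 d, 0 < d &
  forall b, delta <= `|b - 1| -> d <= bregman 1 b.
Proof.
move=> /andP[d0 d2].
pose c1 := 1 + delta / 2; pose c2 := 1 - delta / 2.
have p10 : 0 < p - 1 by rewrite subr_gt0.
have C1 : 1 < c1 `^ (p - 1).
  have := @gt0_ltr_powR R _ p10 1 c1; rewrite powR1; apply.
  - by rewrite nnegrE.
  - by rewrite nnegrE /c1; lra.
  - by rewrite /c1; lra.
have C2 : c2 `^ (p - 1) < 1.
  have := @gt0_ltr_powR R _ p10 c2 1; rewrite powR1; apply.
  - by rewrite nnegrE /c2; lra.
  - by rewrite nnegrE.
  - by rewrite /c2; lra.
exists (Num.min (p * (c1 `^ (p - 1) - 1) * (delta / 2))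
                (p * (1 - c2 `^ (p - 1)) * (delta / 2))).
  by rewrite lt_min !mulr_gt0 ?subr_gt0//; lra.
move=> b; rewrite ge_min ler_normr => /orP[b1|b1]; apply/orP; [left|right].
- apply: le_trans (bregman1_ge b (_ : 0 <= c1)); last by rewrite /c1; lra.
  apply: ler_wpM2l; last by rewrite /c1; lra.
  by apply: mulr_ge0; rewrite ?subr_ge0 ltW.
- apply: le_trans (bregman1_ge b (_ : 0 <= c2)); last by rewrite /c2; lra.
  rewrite -[leRHS]mulrNN -mulrN opprB opprB.
  apply: ler_wpM2l; last by rewrite /c2; lra.
  by apply: mulr_ge0; rewrite ?subr_ge0 ltW.
Qed.

Lemma bregman1_growth : exists2 beta, 0 <= beta &
  forall b, `|b| `^ p <= 2 * (bregman 1 b + beta).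
Proof.
have p10 : 0 < p - 1 by rewrite subr_gt0.
(* With [K ^ (p - 1) = 2], Young's inequality at [K] bounds [p * |b|] by half of [|b| ^ p] plus a
   constant. *)
pose K : R := 2 `^ (p - 1)^-1.
have KE : K `^ (p - 1) = 2 by rewrite /K -powRrM mulVf ?gt_eqF// powRr1.
exists ((p - 1) * K `^ p / 2) => [|b].
  by rewrite !mulr_ge0 ?powR_ge0 ?invr_ge0// ltW.
rewrite bregman1.
have := young_powR (powR_ge0 _ _ : 0 <= K) (normr_ge0 b); rewrite KE.
have : p * b <= p * `|b| by rewrite ler_wpM2l ?(ltW p_gt0)// ler_norm.
by move: p10; lra.
Qed.

(** Near 1 the left side is absorbed by [eta]. Away from 1 the gap bounds every constant by a
    multiple of the divergence, and the growth estimate then bounds [|b| ^ p] likewise. *)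
Lemma bregman1_lower (eta : R) : 0 < eta -> exists2 C, 1 <= C &
  forall b, `|1 - b| `^ p <= C * bregman 1 b + eta.
Proof.
move=> eta0; pose delta := Num.min eta 1.
have [|d d0 dP] := @bregman1_gap delta.
  rewrite lt_min eta0/=; apply/andP; split => //.
  by rewrite (le_lt_trans (_ : delta <= 1)) ?ge_min ?lexx ?orbT// ltr1n.
have [beta beta0 betaP] := bregman1_growth.
(* Obtained from [|1 - b| ^ p <= 2 ^ p * (1 + |b| ^ p)] by inserting [1 <= bregman 1 b / d] and the
   growth estimate. *)
pose C := 2 `^ p * (d^-1 + 2 + 2 * beta / d).
have two1 : 1 <= 2 `^ p :> R.
  by rewrite -[leLHS](@powRr0 R 2) ler_powR ?ler1n// ltW.
exists C => [|b].
  rewrite -[leLHS]mulr1 ler_pM// (@le_trans _ _ 2) ?ler1n//.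
  rewrite -[leLHS]add0r -addrA lerD ?invr_ge0 ?(ltW d0)// lerDl.
  by rewrite !mulr_ge0 ?invr_ge0// ltW.
have D0 := bregman_ge0 1 b.
have [b1|b1] := leP delta `|1 - b|; last first.
  rewrite (@le_trans _ _ eta)// ?lerDr; last first.
    by rewrite mulr_ge0// /C !(mulr_ge0, addr_ge0) ?powR_ge0 ?invr_ge0// ltW.
  have [->|b0] := eqVneq `|1 - b| 0; first by rewrite powR0 ?gt_eqF// ltW.
  rewrite (@le_trans _ _ `|1 - b|)//.
    apply: ge1r_powR; last exact: ltW.
    rewrite lt_def b0 normr_ge0/= (le_trans (ltW b1))//.
    by rewrite ge_min lexx orbT.
  by rewrite (le_trans (ltW b1))// ge_min lexx.
rewrite ler_wpDr ?(ltW eta0)//.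
have {}dP : 1 <= bregman 1 b / d by rewrite ler_pdivlMr// mul1r dP// distrC.
have bP : `|b| `^ p <= 2 * bregman 1 b + 2 * beta / d * bregman 1 b.
  apply: le_trans (betaP b) _; rewrite mulrDr lerD2l.
  by rewrite -!mulrA ler_wpM2l// ler_peMr// mulrC.
apply: (@le_trans _ _ (2 `^ p * (1 + `|b| `^ p))); last first.
  rewrite /C -[leRHS]mulrA ler_wpM2l ?powR_ge0//.
  by rewrite mulrC in dP; move: bP dP; lra.
have h : `|1 - b| <= 2 * Num.max 1 `|b|.
  have := ler_normB 1 b; rewrite normr1.
  have : 1 <= Num.max 1 `|b| by rewrite le_max lexx.
  have : `|b| <= Num.max 1 `|b| by rewrite le_max lexx orbT.
  by lra.
apply: (@le_trans _ _ ((2 * Num.max 1 `|b|) `^ p)).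
  by apply: ge0_ler_powR; rewrite ?nnegrE ?(ltW p_gt0)// (le_trans _ h).
rewrite powRM// ?le_max ?ler01// ler_wpM2l ?powR_ge0//.
have [_|_] := leP 1 `|b|; first by rewrite lerDr.
by rewrite powR1 lerDl powR_ge0.
Qed.

(** For [a] nonzero, write [b = a * (b / a)] and scale. At [a = 0] the divergence is [|b| ^ p],
    whence the condition [1 <= C]. *)
Lemma bregman_lower (eta : R) : 0 < eta -> exists2 C, 1 <= C &
  forall a b, `|a - b| `^ p <= C * bregman a b + eta * `|a| `^ p.
Proof.
move=> /bregman1_lower[C C1 CP]; exists C => // a b.
have [->|a0] := eqVneq a 0.
  rewrite /bregman /dual_pow normr0 powR0 ?gt_eqF// !(mul0r, mulr0).
  by rewrite sub0r normrN subr0 !addr0 ler_peMl// powR_ge0.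
have -> : b = a * (b / a) by rewrite mulrCA divff// mulr1.
rewrite bregmanZ -[X in `|X - _|]mulr1 -mulrBr normrM powRM//.
have := CP (b / a); have := powR_ge0 `|a| p; nra.
Qed.

End bregman.

(** * Exposing functionals on the unit sphere of [L^p] *)

Section Lp_exposed.
Context d (T : measurableType d) (R : realType).
Variables (mu : {measure set T -> \bar R}) (p : R) (p1 : (1 <= p%:E)%E).
Hypothesis p_gt1 : 1 < p.

Local Notation Ls := (LspaceType mu p1).

Let p_gt0 : 0 < p := lt_trans ltr01 p_gt1.

(** The operations of the quotient choose new representatives, so pointwise formulas hold only
    almost everywhere. *)
Lemma LspaceD_ae (u v : Ls) :
  ((u + v : Ls) : T -> R) = (fun x => u x + v x) %[ae mu].
Proof. exact: Lclass_ae. Qed.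

Lemma LspaceN_ae (u : Ls) : ((- u : Ls) : T -> R) = (fun x => - u x) %[ae mu].
Proof. exact: Lclass_ae. Qed.

Lemma LspaceZ_ae (a : R) (u : Ls) :
  ((a *: u : Ls) : T -> R) = (fun x => a * u x) %[ae mu].
Proof. exact: Lclass_ae. Qed.

Lemma measurable_Lspace (u : Ls) : measurable_fun [set: T] u.
Proof. exact: measurable_Q. Qed.

Lemma Lspace_integrable (u : Ls) :
  mu.-integrable [set: T] (EFin \o (fun x => `|u x| `^ p)).
Proof.
by apply: Lfun_integrable; [exact: ltW|exact: Lrepr_subproof].
Qed.

Lemma Lspace_powR_norm (u : Ls) : `|u| `^ p = \int[mu]_x `|u x| `^ p.
Proof. by rewrite Lspace_normE -fine_poweR powR_Lnorm// gt_eqF. Qed.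

Lemma ae_eq_Rintegral (f g : T -> R) :
  measurable_fun [set: T] f -> measurable_fun [set: T] g ->
  f = g %[ae mu] -> \int[mu]_x f x = \int[mu]_x g x.
Proof.
move=> mf mg fg; congr fine; apply: ae_eq_integral => //.
- exact/measurable_EFinP.
- exact/measurable_EFinP.
- by apply: filterS fg => x /= h /h ->.
Qed.

Lemma Lspace_powR_normB (u v : Ls) :
  `|u - v| `^ p = \int[mu]_x `|u x - v x| `^ p.
Proof.
rewrite Lspace_powR_norm; apply: ae_eq_Rintegral.
- exact/measurable_powR_norm/measurable_Lspace.
- by apply/measurable_powR_norm/measurable_funB; exact: measurable_Lspace.
- apply: filterS2 (LspaceD_ae u (- v)) (LspaceN_ae v) => x /= /(_ I) uv /(_ I) v' _.
  by rewrite uv v'.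
Qed.

(** For [|u| = 1], this is the functional of norm 1 that attains its norm at [u]. *)
Definition pairing (u v : Ls) : R := \int[mu]_x (dual_pow p (u x) * v x).

Lemma measurable_pairing (u v : Ls) :
  measurable_fun [set: T] (fun x => dual_pow p (u x) * v x).
Proof.
apply: measurable_funM; last exact: measurable_Lspace.
by apply: (measurableT_comp (measurable_dual_pow p)); exact: measurable_Lspace.
Qed.

Lemma integrable_young (u v : Ls) : mu.-integrable [set: T]
  (EFin \o (fun x => `|v x| `^ p + (p - 1) * `|u x| `^ p)).
Proof.
exact: (integrableD measurableT (Lspace_integrable v)
  (integrableZl measurableT (p - 1) (Lspace_integrable u))).
Qed.

Lemma integrable_pairing (u v : Ls) :
  mu.-integrable [set: T] (EFin \o (fun x => dual_pow p (u x) * v x)).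
Proof.
have i := integrable_young u v.
apply: le_integrable i => //; first exact/measurable_EFinP/measurable_pairing.
move=> x _ /=; rewrite lee_fin (le_trans _ (ler_norm _))//.
apply: le_trans (norm_dual_powM_le p_gt1 (u x) (v x)).
by rewrite ler_peMl// ltW.
Qed.

Lemma pairing_scalar (u : Ls) : scalar (pairing u).
Proof.
move=> a v w; rewrite /pairing.
transitivity (\int[mu]_x (a * (dual_pow p (u x) * v x) + dual_pow p (u x) * w x)).
  apply: ae_eq_Rintegral; first exact: measurable_pairing.
    apply: measurable_funD; last exact: measurable_pairing.
    by apply: measurable_funM => //; exact: measurable_pairing.
  apply: filterS2 (LspaceD_ae (a *: v) w) (LspaceZ_ae a v).
  by move=> x /= /(_ I) vw /(_ I) av _; rewrite vw av; ring.
rewrite RintegralD// ?RintegralZl//; first exact: integrable_pairing.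
- exact: (integrableZl measurableT a (integrable_pairing u v)).
- exact: integrable_pairing.
Qed.

Lemma integrable_bregman (u v : Ls) :
  mu.-integrable [set: T] (EFin \o (fun x => bregman p (u x) (v x))).
Proof.
exact: (integrableB measurableT (integrable_young u v)
  (integrableZl measurableT p (integrable_pairing u v))).
Qed.

Lemma Rintegral_bregman (u v : Ls) :
  \int[mu]_x bregman p (u x) (v x) =
  `|v| `^ p + (p - 1) * `|u| `^ p - p * pairing u v.
Proof.
have iu := Lspace_integrable u; have iv := Lspace_integrable v.
have iuv := integrable_pairing u v.
rewrite RintegralB//; last 2 first.
- exact: integrable_young.
- exact: (integrableZl measurableT p iuv).
rewrite RintegralD//; last exact: (integrableZl measurableT (p - 1) iu).
by rewrite !RintegralZl// -!Lspace_powR_norm.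
Qed.

(** Integrating the nonnegative divergence gives [p * pairing u v <= |v| ^ p + p - 1 <= p]. *)
Lemma pairing_le1 (u v : Ls) : `|u| = 1 -> `|v| <= 1 -> pairing u v <= 1.
Proof.
move=> u1 v1.
have : 0 <= \int[mu]_x bregman p (u x) (v x).
  by apply: Rintegral_ge0 => x _; exact: bregman_ge0.
have vp : `|v| `^ p <= 1.
  by rewrite -[leRHS](congr1 (@^~ p) (powR1 R)) ge0_ler_powR ?nnegrE// ltW.
rewrite Rintegral_bregman u1 powR1 /= => uv.
by rewrite -(ler_pM2l p_gt0); move: vp uv; lra.
Qed.

Lemma norm_pairing (u v : Ls) : `|u| = 1 -> `|pairing u v| <= `|v|.
Proof.
move=> u1.
have pZ a w : pairing u (a *: w) = a * pairing u w.
  have p0 : pairing u 0 = 0.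
    have := pairing_scalar u (-1) 0 0.
    by rewrite scaler0 addr0 mulN1r addNr.
  by have := pairing_scalar u a w 0; rewrite addr0 p0 addr0.
have [->|v0] := eqVneq v 0.
  by rewrite -(scale0r 0) pZ mul0r normr0 normr_ge0.
have nv0 : 0 < `|v| by rewrite normr_gt0.
have le w : `|w| = `|v| -> pairing u w <= `|v|.
  move=> wv; rewrite -[leRHS]mul1r -ler_pdivrMr// mulrC -pZ pairing_le1// normrZ wv.
  by rewrite normfV normr_id mulVf// gt_eqF.
rewrite ler_norml le// andbT lerNl -mulN1r -pZ le// scaleN1r normrN//.
Qed.

Lemma pairing_exposes (eps : R) : 0 < eps ->
  exists2 t, 0 < t & forall u : Ls, `|u| = 1 ->
    exists f, @exposes R Ls f u t eps.
Proof.
move=> eps0; have ep0 : 0 < eps `^ p by rewrite powR_gt0.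
have [|C C1 CP] := @bregman_lower R p p_gt1 (eps `^ p / 2).
  by rewrite divr_gt0.
have C0 : 0 < C by rewrite (lt_le_trans _ C1).
(* Chosen so that [C * p * t = eps ^ p / 2]: the divergence term then stays below half of [eps ^ p],
   the other half being the [eta] term. *)
exists (eps `^ p / 2 / (C * p)); first by rewrite !divr_gt0// mulr_gt0.
move=> u u1; exists (pairing u); split.
- exact: pairing_scalar.
- by move=> v; exact: norm_pairing.
- rewrite /pairing; under eq_Rintegral do rewrite dual_powM//.
  by rewrite -Lspace_powR_norm u1 powR1.
move=> v v1 tv.
have vp : `|v| `^ p <= 1.
  by rewrite -[leRHS](congr1 (@^~ p) (powR1 R)) ge0_ler_powR ?nnegrE// ltW.
have : `|u - v| `^ p <= C * (`|v| `^ p + (p - 1) * `|u| `^ p - p * pairing u v)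
   + eps `^ p / 2 * `|u| `^ p.
  rewrite Lspace_powR_normB -Rintegral_bregman [in X in _ <= _ + X]Lspace_powR_norm.
  have iu : mu.-integrable [set: T] (EFin \o (fun x => eps `^ p / 2 * `|u x| `^ p)).
    exact: (integrableZl measurableT (eps `^ p / 2) (Lspace_integrable u)).
  have ib : mu.-integrable [set: T] (EFin \o (fun x => C * bregman p (u x) (v x))).
    exact: (integrableZl measurableT C (integrable_bregman u v)).
  have ibu := integrableD measurableT ib iu.
  rewrite -(RintegralZl C measurableT (integrable_bregman u v)).
  rewrite -(RintegralZl (eps `^ p / 2) measurableT (Lspace_integrable u)).
  rewrite -(RintegralD measurableT ib iu).
  apply: (le_Rintegral measurableT _ ibu) => [|x _]; last exact: CP.
  apply: le_integrable ibu => //.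
    apply/measurable_EFinP/measurable_powR_norm/measurable_funB;
      exact: measurable_Lspace.
  move=> x _ /=; rewrite lee_fin ger0_norm ?powR_ge0//.
  by rewrite (le_trans _ (ler_norm _))// CP.
rewrite u1 powR1 /= !mulr1 => uv; rewrite ltNge; apply/negP => uv_ge.
have : eps `^ p <= `|u - v| `^ p.
  by rewrite ge0_ler_powR ?nnegrE// ?ltW// ltW.
move: tv; rewrite ltrBlDr -ltrBlDl ltr_pdivlMr ?mulr_gt0// => tv.
have : C * (`|v| `^ p + (p - 1) - p * pairing u v) <= (1 - pairing u v) * (C * p).
  rewrite [leRHS]mulrCA ler_pM2l//; lra.
lra.
Qed.

End Lp_exposed.

(** * Rational spans, their closures, and dense sequences in the unit sphere *)

Section rational_span.
Context (R : realType) (X : normedModType R) (g : nat -> X).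

(** Lists of pairs form a countable type, so [unpickle] enumerates the combinations. *)
Definition rat_comb (s : seq (rat * nat)) : X :=
  \sum_(q <- s) (ratr q.1 : R) *: g q.2.

Definition adherent (u : X) :=
  forall eps, 0 < eps -> exists s, `|u - rat_comb s| < eps.

Lemma adherent_closed u :
  (forall eps, 0 < eps -> exists2 v, adherent v & `|u - v| < eps) -> adherent u.
Proof.
move=> uP eps eps0; have e2 : 0 < eps / 2 by rewrite divr_gt0.
have [v vP uv] := uP _ e2; have [s vs] := vP _ e2.
exists s; rewrite -(subrKA v) (le_lt_trans (ler_normD _ _))//.
by rewrite [ltRHS]splitr ltrD.
Qed.

Lemma adherentD u v : adherent u -> adherent v -> adherent (u + v).
Proof.
move=> uP vP eps eps0; have e2 : 0 < eps / 2 by rewrite divr_gt0.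
have [s us] := uP _ e2; have [t vt] := vP _ e2.
exists (s ++ t); rewrite /rat_comb big_cat/= opprD addrACA.
by rewrite (le_lt_trans (ler_normD _ _))// [ltRHS]splitr ltrD.
Qed.

Lemma adherent0 : adherent 0.
Proof. by move=> eps eps0; exists [::]; rewrite /rat_comb big_nil subrr normr0. Qed.

Lemma adherentZ_gen a n : adherent (a *: g n).
Proof.
move=> eps eps0; pose k := `|g n| + 1.
have k0 : 0 < k by rewrite ltr_wpDl.
have [q] := rat_in_itvoo (ltr_pwDr (divr_gt0 eps0 k0) (lexx a)).
rewrite in_itv/= => /andP[aq qa].
exists [:: (q, n)]; rewrite /rat_comb big_seq1 -scalerBl normrZ.
apply: (@le_lt_trans _ _ (`|a - ratr q| * k)); first by rewrite ler_wpM2l// lerDl.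
by rewrite -ltr_pdivlMr// distrC ger0_norm; lra.
Qed.

(** A real multiple of a rational combination is a sum of real multiples of generators, each
    adherent by density of the rationals; closedness then handles general [u]. *)
Lemma adherentZ a u : adherent u -> adherent (a *: u).
Proof.
move=> uP; apply: adherent_closed => eps eps0.
have k0 : 0 < `|a| + 1 by rewrite ltr_wpDl.
have [s us] := uP _ (divr_gt0 eps0 k0).
exists (a *: rat_comb s).
  rewrite /rat_comb scaler_sumr; elim/big_ind : _; first exact: adherent0.
    exact: adherentD.
  by move=> q _; rewrite scalerA; exact: adherentZ_gen.
rewrite -scalerBr normrZ (@le_lt_trans _ _ ((`|a| + 1) * `|u - rat_comb s|))//.
  by rewrite ler_wpM2r// lerDl.
by rewrite mulrC -ltr_pdivlMr.
Qed.

Lemma adherent_gen n : adherent (g n).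
Proof. by rewrite -[g n]scale1r; exact: adherentZ_gen. Qed.

Lemma adherent_countable : (forall u, adherent u) ->
  exists e : nat -> X, forall u eps, 0 < eps -> exists n, `|u - e n| < eps.
Proof.
move=> h; exists (fun n => if unpickle n is Some s then rat_comb s else 0).
by move=> u eps /(h u)[s us]; exists (pickle s); rewrite pickleK.
Qed.

End rational_span.

(** Normalising [e n] moves it by the distance from [|e n|] to 1, which is at most [|u - e n|]. The
    vector [z] replaces the zero terms. *)
Lemma dense_sphere (R : realType) (X : normedModType R) (z : X) (e : nat -> X) :
  z != 0 -> (forall u eps, 0 < eps -> exists n, `|u - e n| < eps) ->
  exists2 e' : nat -> X, (forall n, `|e' n| = 1) &
    forall u eps, `|u| = 1 -> 0 < eps -> exists n, `|u - e' n| < eps.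
Proof.
have normalized (v : X) : v != 0 -> `| `|v|^-1 *: v | = 1.
  by move=> v0; rewrite normrZ normfV normr_id mulVf// normr_eq0.
move=> z0 eP; exists (fun n => if e n == 0 then `|z|^-1 *: z else `|e n|^-1 *: e n).
  by move=> n; case: eqVneq => [_|en0]; exact: normalized.
move=> u eps u1 eps0.
(* The bound by 1 forces [e n] to be nonzero. *)
have [|n] := eP u (Num.min 1 (eps / 2)); first by rewrite lt_min ltr01 divr_gt0.
rewrite lt_min => /andP[un1 un]; exists n => /=.
have [en0|en0] := eqVneq (e n) 0; first by move: un1; rewrite en0 subr0 u1 ltxx.
rewrite -(subrKA (e n)) (le_lt_trans (ler_normD _ _))//.
have -> : e n - `|e n|^-1 *: e n = (`|e n| - 1) *: (`|e n|^-1 *: e n).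
  by rewrite scalerBl scale1r scalerA divff ?scale1r// normr_eq0.
rewrite normrZ normalized// mulr1 [ltRHS]splitr ltrD//.
by rewrite -[in ltLHS]u1 (le_lt_trans (ler_dist_dist _ _))// distrC.
Qed.

(** * Separability of [L^p] of a finite measure with a countable dense family of sets *)

Section Lspace_separable.
Local Open Scope classical_set_scope.
Context d (T : measurableType d) (R : realType).
Variables (mu : {measure set T -> \bar R}) (p : R) (p1 : (1 <= p%:E)%E).
Hypothesis p_gt1 : 1 < p.
Hypothesis mu_fin : (mu [set: T] < +oo)%E.

Local Notation Ls := (LspaceType mu p1).

Let p_gt0 : 0 < p := lt_trans ltr01 p_gt1.

Lemma Lspace_of (f : T -> R) : measurable_fun [set: T] f ->
  mu.-integrable [set: T] (EFin \o (fun x => `|f x| `^ p)) ->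
  exists u : Ls, (u : T -> R) = f %[ae mu].
Proof.
move=> mf fp.
have fL : f \in Lfun mu p%:E.
  rewrite inE/=; apply/andP; split; rewrite inE//=.
  by rewrite /finite_norm unlock poweR_lty//; exact: integrable_lty.
by exists (Lclass (Lfun_Sub p1 fL)); exact: Lclass_ae.
Qed.

Lemma Lspace_powR_normB_ae (u v : Ls) (f g : T -> R) :
  measurable_fun [set: T] f -> measurable_fun [set: T] g ->
  (u : T -> R) = f %[ae mu] -> (v : T -> R) = g %[ae mu] ->
  `|u - v| `^ p = \int[mu]_x `|f x - g x| `^ p.
Proof.
move=> mf mg uf vg; rewrite Lspace_powR_normB//; apply: ae_eq_Rintegral.
- by apply/measurable_powR_norm/measurable_funB; exact: measurable_Lspace.
- exact/measurable_powR_norm/measurable_funB.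
- by apply: filterS2 uf vg => x /= /(_ I) -> /(_ I) ->.
Qed.

Lemma indic_powR (A : set T) x : `|\1_A x : R| `^ p = \1_A x.
Proof.
by rewrite indicE; case: (_ \in _); rewrite ?normr1 ?powR1// normr0 powR0// gt_eqF.
Qed.

Lemma integrable_indic_fin (A : set T) : measurable A ->
  mu.-integrable [set: T] (EFin \o (\1_A : T -> R)).
Proof.
move=> mA; apply/integrableP; split.
  exact/measurable_EFinP/measurable_indic.
under eq_integral do rewrite /= ger0_norm//.
rewrite integral_indic// setIT (le_lt_trans _ mu_fin)//.
by rewrite le_measure ?inE.
Qed.

Lemma Lspace_indic (A : set T) : measurable A ->
  exists u : Ls, (u : T -> R) = \1_A %[ae mu].
Proof.
move=> mA; apply: Lspace_of; first exact: measurable_indic.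
apply: eq_integrable (integrable_indic_fin mA) => // x _ /=.
by rewrite indic_powR.
Qed.

Lemma Lspace_sum_ae (J : Type) (s : seq J) (F : J -> Ls) (f : J -> T -> R) :
  (forall i, (F i : T -> R) = f i %[ae mu]) ->
  ((\sum_(i <- s) F i : Ls) : T -> R) = (fun x => \sum_(i <- s) f i x) %[ae mu].
Proof.
move=> Ff; elim: s => [|i s ih].
  rewrite big_nil; apply: filterS (Lclass_ae (0 : LfunType mu p1)).
  by move=> x /= + _ => /(_ I) ->; rewrite big_nil.
rewrite big_cons; apply: filterS3 (LspaceD_ae (F i) (\sum_(j <- s) F j)) (Ff i) ih.
by move=> x /= /(_ I) -> /(_ I) -> /(_ I) -> _; rewrite big_cons.
Qed.

Variables (V : nat -> set T) (g : nat -> Ls).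
Hypothesis mV : forall n, measurable (V n).
Hypothesis V_dense : forall A (eps : R), measurable A -> 0 < eps ->
  exists n, (mu ((A `\` V n) `|` (V n `\` A)) < eps%:E)%E.
Hypothesis gV : forall n, (g n : T -> R) = \1_(V n) %[ae mu].

Lemma powR_lt_cancel (x eps : R) : 0 <= x -> 0 < eps -> x `^ p < eps `^ p -> x < eps.
Proof.
move=> x0 e0; apply: contraTT; rewrite -!leNgt => ex.
by rewrite ge0_ler_powR ?nnegrE// ltW.
Qed.

(** The [p]-th power of the distance between two indicators is the measure of the symmetric
    difference. *)
Lemma adherent_indic (A : set T) (u : Ls) : measurable A ->
  (u : T -> R) = \1_A %[ae mu] -> adherent g u.
Proof.
move=> mA uA; apply: adherent_closed => eps eps0.
have [n nA] := V_dense mA (powR_gt0 p eps0).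
exists (g n); first exact: adherent_gen.
apply: powR_lt_cancel => //.
rewrite (Lspace_powR_normB_ae _ _ uA (gV n)); try exact: measurable_indic.
have mB : measurable ((A `\` V n) `|` (V n `\` A)).
  by apply: measurableU; exact: measurableD.
rewrite (_ : (fun x => _) = \1_((A `\` V n) `|` (V n `\` A))); last first.
  apply/funext => x; rewrite -[RHS]indic_powR !indicE in_setU !in_setD.
  case: (x \in A); case: (x \in V n) => /=;
    by rewrite ?subrr ?subr0 ?sub0r ?normrN.
rewrite /Rintegral integral_indic// setIT -lte_fin fineK//.
by rewrite ge0_fin_numE// (lt_trans nA)// ltry.
Qed.

Import HBNNSimple.

Lemma adherent_nnsfun (f : {nnsfun T >-> R}) (u : Ls) :
  (u : T -> R) = f %[ae mu] -> adherent g u.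
Proof.
move=> uf.
have : forall y : R, exists w : Ls, (w : T -> R) = \1_(f @^-1` [set y]) %[ae mu].
  by move=> y; apply: Lspace_indic; exact: measurable_funPTI.
move=> /choice[w wP].
pose s := finmap.enum_fset (fset_set (range f)).
have -> : u = \sum_(y <- s) y *: w y.
  apply: Lspace_eqP; apply: ae_eq_trans uf _; apply: ae_eq_sym.
  have yw y : ((y *: w y : Ls) : T -> R) = (fun x => y * \1_(f @^-1` [set y]) x) %[ae mu].
    apply: filterS2 (LspaceZ_ae y (w y)) (wP y).
    by move=> x /= /(_ I) -> /(_ I) ->.
  apply: ae_eq_trans (Lspace_sum_ae s yw) _.
  apply: nearW => x /= _; rewrite fimfunE fsbig_finite//=.
elim/big_ind : _; [exact: adherent0|exact: adherentD|move=> y _].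
by apply/adherentZ/(adherent_indic _ (wP y)); exact: measurable_funPTI.
Qed.

(** Simple functions [h n] with [0 <= h n <= f] converge to [f] pointwise, hence in norm by
    dominated convergence with bound [|f| ^ p]. *)
Lemma adherent_ge0 (f : T -> R) (u : Ls) : measurable_fun [set: T] f ->
  (forall x, 0 <= f x) -> (u : T -> R) = f %[ae mu] -> adherent g u.
Proof.
move=> mf f0 uf; apply: adherent_closed => eps eps0.
have mF : measurable_fun [set: T] (EFin \o f) by exact/measurable_EFinP.
pose h := nnsfun_approx measurableT mF.
have hf n x : h n x <= f x.
  by rewrite -lee_fin /h nnsfun_approxE; apply: le_approx => // y _; rewrite lee_fin.
have hcvg x : h n x @[n --> \oo] --> f x.
  have F0 y : [set: T] y -> (0 <= (EFin \o f) y)%E by move=> _; rewrite lee_fin.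
  exact: (fine_cvg (cvg_nnsfun_approx measurableT mF F0 (I : [set: T] x))).
have fp : mu.-integrable [set: T] (EFin \o (fun x => `|f x| `^ p)).
  apply/integrableP; split; first exact/measurable_EFinP/measurable_powR_norm.
  have /integrableP[_] := Lspace_integrable p_gt1 u.
  congr (_ < _)%E; apply: ae_eq_integral => //.
  - apply: measurableT_comp => //.
    exact/measurable_EFinP/measurable_powR_norm/measurable_Lspace.
  - by apply: measurableT_comp => //; exact/measurable_EFinP/measurable_powR_norm.
  - by apply: filterS uf => x /= /(_ I) ->.
have hp n : mu.-integrable [set: T] (EFin \o (fun x => `|h n x| `^ p)).
  apply: le_integrable fp => //; first exact/measurable_EFinP/measurable_powR_norm.
  move=> x _ /=; rewrite lee_fin !ger0_norm ?powR_ge0//.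
  by rewrite ge0_ler_powR ?nnegrE// ltW.
pose D n x := (`|f x - h n x| `^ p)%:E.
have mD n : measurable_fun [set: T] (D n).
  exact/measurable_EFinP/measurable_powR_norm/measurable_funB.
(* Once [|f x - h n x| < 1], its [p]-th power is at most itself. *)
have D0 x : D ^~ x @ \oo --> 0%E.
  apply: cvg_EFin; first exact: nearW.
  apply/cvgrPdist_lt => e e0; near=> n.
  have fh : `|f x - h n x| < Num.min 1 e.
    by near: n; move/cvgrPdist_lt : (hcvg x); apply; rewrite lt_min ltr01.
  rewrite /= sub0r normrN ger0_norm ?powR_ge0//.
  move: fh; rewrite lt_min => /andP[fh1 fhe]; apply: le_lt_trans fhe.
  have [->|fh0] := eqVneq `|f x - h n x| 0; first by rewrite powR0// gt_eqF.
  by apply: ge1r_powR; rewrite ?(ltW p_gt1)// lt_def fh0 normr_ge0/= ltW.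
have Df x n : (`|D n x| <= (`|f x| `^ p)%R%:E)%E.
  rewrite /= lee_fin !ger0_norm ?powR_ge0 ?subr_ge0//.
  by rewrite ge0_ler_powR ?nnegrE ?subr_ge0 ?(ltW p_gt0)// gerBl.
have [_ _] := @dominated_convergence _ _ _ mu _ measurableT D (cst 0%E)
  (EFin \o (fun x => `|f x| `^ p)) mD (measurable_cst _)
  (aeW mu (fun x _ => D0 x)) fp (aeW mu (fun x n _ => Df x n)).
rewrite integral0 => /fine_cvg/cvgrPdist_lt/(_ _ (powR_gt0 p eps0))[n _ /(_ n (leqnn n))].
rewrite sub0r normrN => fhn.
have [w wP] : exists w : Ls, (w : T -> R) = h n %[ae mu] by exact: Lspace_of (hp n).
exists w; first exact: adherent_nnsfun wP.
apply: powR_lt_cancel => //; rewrite (Lspace_powR_normB_ae _ _ uf wP)//.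
exact: le_lt_trans (ler_norm _) fhn.
Unshelve. all: by end_near. Qed.

Lemma adherent_Lspace (u : Ls) : adherent g u.
Proof.
have mu' := measurable_Lspace u.
have mpos : measurable_fun [set: T] u^\+ by exact: measurable_funrpos.
have mneg : measurable_fun [set: T] u^\- by exact: measurable_funrneg.
have up (v : T -> R) : measurable_fun [set: T] v -> (forall x, `|v x| <= `|u x|) ->
    mu.-integrable [set: T] (EFin \o (fun x => `|v x| `^ p)).
  move=> mv vu; apply: le_integrable (Lspace_integrable p_gt1 u) => //.
    exact/measurable_EFinP/measurable_powR_norm.
  move=> x _ /=; rewrite lee_fin !(ger0_norm (powR_ge0 _ _)).
  by rewrite ge0_ler_powR ?nnegrE ?(ltW p_gt0)// vu.
have [v vP] : exists v : Ls, (v : T -> R) = u^\+ %[ae mu].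
  apply: Lspace_of => //; apply: up => // x.
  by rewrite /funrpos /=; case: (leP (u x) 0); rewrite ?normr0 ?normr_ge0 ?lexx.
have [w wP] : exists w : Ls, (w : T -> R) = u^\- %[ae mu].
  apply: Lspace_of => //; apply: up => // x.
  by rewrite /funrneg /=; case: (leP (- u x) 0); rewrite ?normr0 ?normrN ?normr_ge0 ?lexx.
have -> : u = v + (-1) *: w.
  apply: Lspace_eqP; apply: ae_eq_sym.
  apply: filterS3 (LspaceD_ae v (-1 *: w)) (LspaceZ_ae (-1) w) (filterI vP wP).
  move=> x /= /(_ I) -> /(_ I) -> [/(_ I) -> /(_ I) ->] _.
  by rewrite mulN1r -[RHS](congr1 (@^~ x) (funrposBneg u)).
apply: adherentD; last apply: adherentZ.
- exact: (adherent_ge0 mpos (funrpos_ge0 _) vP).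
- exact: (adherent_ge0 mneg (funrneg_ge0 _) wP).
Qed.

End Lspace_separable.

(** * Approximation of measurable sets by finite unions of rational intervals *)

Section unit_interval.
Local Open Scope classical_set_scope.
Context (R : realType).
Local Notation T := (measurableTypeR R).

Definition rat_itvs (s : seq (rat * rat)) : set T :=
  \big[setU/set0]_(q <- s) (`]ratr q.1, ratr q.2[ : set R).

Lemma measurable_rat_itvs s : measurable (rat_itvs s).
Proof.
by rewrite /rat_itvs; elim/big_ind : _ => // A B mA mB; exact: measurableU.
Qed.

Lemma lebesgue01_setT : lebesgue01 R [set: T] = 1%E.
Proof.
by rewrite /lebesgue01/= /mrestr setTI lebesgue_measure_itv/= lte_fin ltr01 oppr0 adde0.
Qed.

Lemma lebesgue01_fin : (lebesgue01 R [set: T] < +oo)%E.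
Proof. by rewrite lebesgue01_setT ltry. Qed.

Lemma open_rat_itv (U : set R) x : open U -> U x ->
  exists2 q : rat * rat, `]ratr q.1, ratr q.2[ `<=` U & `]ratr q.1, ratr q.2[ x.
Proof.
rewrite openE => /(_ x)/[apply] /nbhs_ballP[e /= e0 xeU].
have /rat_in_itvoo[a] : x - e < x by rewrite ltrBlDr ltrDl.
rewrite in_itv/= => /andP[ea ax].
have /rat_in_itvoo[b] : x < x + e by rewrite ltrDl.
rewrite in_itv/= => /andP[xb be].
exists (a, b); last by rewrite /= in_itv/= ax.
move=> y /=; rewrite in_itv/= => /andP[ay yb].
apply: xeU; rewrite -ball_normE/= ltr_norml; lra.
Qed.

(** Outer regularity gives an open [U] of small excess; [U] is a countable union of rational
    intervals, and continuity from above makes a finite subunion sufficient. *)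
Lemma lebesgue01_rat_itvs (A : set T) (eps : R) : measurable A -> 0 < eps ->
  exists s, (lebesgue01 R ((A `\` rat_itvs s) `|` (rat_itvs s `\` A)) < eps%:E)%E.
Proof.
move=> mA eps0; pose m := lebesgue01 R.
have mI : measurable (`[0, 1] : set T) by exact: measurable_itv.
(* Outer regularity requires finite Lebesgue measure, which [A] may lack. *)
pose A' : set T := A `&` `[0, 1].
have mA' : measurable A' by exact: measurableI.
have A'fin : (lebesgue_measure A' < +oo)%E.
  apply: (@le_lt_trans _ _ (m [set: T])); last exact: lebesgue01_fin.
  by rewrite /m /lebesgue01/= /mrestr setTI le_measure ?inE//; exact: subIsetr.
have e2 : 0 < eps / 2 by rewrite divr_gt0.
have [U [oU AU UA]] := lebesgue_regularity_outer mA' A'fin e2.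
have mU : measurable (U : set T) by exact: open_measurable.
pose W k : set T := if unpickle k is Some q then
    if `[< (`]ratr q.1, ratr q.2[ : set R) `<=` U >]
    then `]ratr (q : rat * rat).1, ratr q.2[ else set0
  else set0.
have mW k : measurable (W k) by rewrite /W; case: unpickle => // q; case: ifP.
pose G N : set T := U `\` \big[setU/set0]_(k < N) W k.
have mG N : measurable (G N).
  by apply: measurableD => //; exact: bigsetU_measurable.
have G0 : \bigcap_N G N = set0.
  apply/seteqP; split => // x Gx; have [Ux _] := Gx 0%N I.
  have [q qU qx] := open_rat_itv oU Ux.
  (* The union in [G N] runs over [k < N], hence the successor. *)
  have [_] := Gx (pickle q).+1 I; apply; rewrite big_ord_recr/=; right.
  by rewrite /W pickleK; case: asboolP.
have Gcvg : m \o G @ \oo --> 0%E.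
  rewrite -(measure0 m) -G0; apply: nonincreasing_cvg_mu => //.
  - apply: le_lt_trans lebesgue01_fin.
    by rewrite le_measure ?inE.
  - exact: bigcapT_measurable.
  - move=> i j ij; apply/subsetPset; apply: setDS.
    exact: subset_bigsetU.
have [N GN] : exists N, (m (G N) < (eps / 2)%:E)%E.
  move/fine_cvg/cvgrPdist_lt : (Gcvg) => /(_ _ e2)[N _ /(_ N (leqnn N))].
  rewrite sub0r normrN => /(le_lt_trans (ler_norm _)) GN; exists N.
  rewrite -[m (G N)]fineK ?lte_fin// ge0_fin_numE//.
  by apply: le_lt_trans lebesgue01_fin; rewrite le_measure ?inE.
have [s sW] : exists s, rat_itvs s = \big[setU/set0]_(k < N) W k.
  elim: N {GN} => [|N [s sW]]; first by exists [::]; rewrite /rat_itvs big_nil big_ord0.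
  rewrite big_ord_recr/= -sW /W; case: unpickle => [q|]; last by exists s; rewrite setU0.
  case: ifP => _; last by exists s; rewrite setU0.
  by exists (rcons s q); rewrite /rat_itvs -cats1 big_cat big_seq1.
exists s.
have mV := measurable_rat_itvs s.
(* Inside [[0, 1]], points of [A] missed by the union lie in [G N], and points of the union outside
   [A] lie in [U] but not in [A']. *)
apply: (@le_lt_trans _ _ (lebesgue_measure (U `\` A') + m (G N))%E); last first.
  by rewrite [in ltRHS](splitr eps) EFinD lteD.
rewrite /m /lebesgue01/= /mrestr.
apply: (@le_trans _ _
  (lebesgue_measure ((U `\` A') `|` (G N `&` `[0, 1])))).
  rewrite le_measure ?inE//.
  - apply: measurableI => //; apply: measurableU; exact: measurableD.
  - apply: measurableU; first exact: measurableD.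
    by apply: measurableI.
  - move=> x [[[Ax Vx]|[Vx Ax]] x01].
      right; split => //; split; last by rewrite -sW.
      by apply: AU.
    left; split; last by case=> /Ax.
    move: Vx; rewrite sW; elim/big_ind : _ => // [B C BU CU [/BU|/CU]//|k _].
    by rewrite /W; case: unpickle => // q; case: asboolP => // qU; exact: qU.
by apply: measureU2; [exact: measurableD|exact: measurableI].
Qed.

End unit_interval.

Theorem theorem1p3 (R : realType) (p : R) (hp : 3 / 2 < p < 3) :
  UBCP (Bop (Lp01 (exponent_ge1 hp))).
Proof.
have p_gt1 : 1 < p by case/andP: hp; lra.
pose V n : set (measurableTypeR R) := rat_itvs (odflt [::] (unpickle n)).
have mV n : measurable (V n) by exact: measurable_rat_itvs.
have [g gV] := choice (fun n =>
  Lspace_indic (exponent_ge1 hp) p_gt1 (lebesgue01_fin R) (mV n)).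
have V_dense A (eps : R) : measurable A -> 0 < eps ->
    exists n, (lebesgue01 R ((A `\` V n) `|` (V n `\` A))%classic < eps%:E)%E.
  move=> mA /(lebesgue01_rat_itvs mA)[s sA].
  by exists (pickle s); rewrite /V pickleK.
have [e eP] := adherent_countable
  (adherent_Lspace p_gt1 (lebesgue01_fin R) mV V_dense gV).
(* The class of the constant 1 is the nonzero vector required for normalising the dense sequence. *)
have [z zT] := Lspace_indic (exponent_ge1 hp) p_gt1 (lebesgue01_fin R) measurableT.
have z1 : `|z| `^ p = 1.
  rewrite (Lspace_powR_norm p_gt1) (@ae_eq_Rintegral _ _ _ _ _ \1_[set: _]%classic).
  - by rewrite /Rintegral integral_indic// setIT lebesgue01_setT.
  - exact/measurable_powR_norm/measurable_Lspace.
  - exact: measurable_indic.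
  - by apply: filterS zT => x /= /[apply] ->; rewrite indic_powR.
have z0 : z != 0.
  apply/eqP => z0; move: z1; rewrite z0 normr0 powR0 ?gt_eqF ?(lt_trans ltr01)//.
  by move/esym/eqP; rewrite oner_eq0.
have [e' e'1 e'P] := dense_sphere z0 eP.
by apply: (ubcp_exposed e'1 e'P); exact: pairing_exposes.
Qed.
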